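(* Let $P_1$ be the uniform distribution on $[0,\frac12]$, let $P_2$ be the discrete distribution with mass $\frac13$ at each point of $D=\{\frac23,\frac56,1\}$, and let $P=\frac12P_1+\frac12P_2$. Then the quantization dimension $D(P)$ of $P$ exists, and $D(P)=D(P_1)=1$.
   Context: For a Borel probability measure $Q$ on $\mathbb R$ with finite second moment, the $n$th quantization error is $V_n(Q)=\inf\{\int\min_{a\in\alpha}(x-a)^2\,dQ(x):\alpha\subset\mathbb R,\ 1\le\mathrm{card}(\alpha)\le n\}$. The quantization dimension of $Q$ is $D(Q)=\lim_{n\to\infty}\frac{2\log n}{-\log V_n(Q)}$, when this limit exists. *)

(* Defs.v *)
From HB Require Import structures.
From mathcomp Require Import all_boot all_order all_algebra finmap.
From mathcomp Require Import all_classical all_reals all_analysis.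

Set Implicit Arguments.
Unset Strict Implicit.
Unset Printing Implicit Defensive.

Import Order.TTheory GRing.Theory Num.Theory.
Import numFieldNormedType.Exports.

Local Open Scope classical_set_scope.
Local Open Scope ring_scope.

Section quantization.
Context {R : realType}.
Implicit Types (Q : probability (measurableTypeR R) R) (alpha : {fset R}).

(* The minimum is taken in [\bar R], where +oo is neutral for min; for the
   nonempty [alpha] used below it is the minimum over the points of [alpha]. *)
Definition distortion Q alpha : \bar R :=
  (\int[Q]_x \big[Order.min/+oo]_(a <- alpha) ((x - a) ^+ 2)%:E)%E.

(* [fine] sends infinite values to 0: the definition is meaningful when Q has
   a finite second moment and n > 0, in which case the infimum is finite. *)
Definition quantization_error Q (n : nat) : R :=
  fine (ereal_inf [set distortion Q alpha | alpha in
                     [set alpha : {fset R} | (1 <= #|` alpha| <= n)%N]]).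

Definition quantization_ratio Q : R^nat :=
  fun n => (2 * ln n%:R) / (- ln (quantization_error Q n)).

Definition quantization_dim_exists Q : Prop := cvgn (quantization_ratio Q).

(* Meaningful only under [quantization_dim_exists Q]. *)
Definition quantization_dim Q : R := limn (quantization_ratio Q).

End quantization.

Section distributions.
Context (R : realType).

Lemma half_gt0 : 0 < 2^-1 :> R.
Proof. by rewrite invr_gt0 ltr0n. Qed.

Definition P1 : set (measurableTypeR R) -> \bar R := uniform_prob half_gt0.

HB.instance Definition _ := Probability.on P1.

Definition P2_support : seq R := [:: 2 / 3; 5 / 6; 1].

Definition P2 : set (measurableTypeR R) -> \bar R :=
  mscale (3^-1)%:nng
    (msum (fun k => @dirac _ (measurableTypeR R) P2_support`_k R)
       (size P2_support)).

HB.instance Definition _ := Measure.on P2.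

Let P2_setT : P2 setT = 1%E.
Proof.
rewrite /P2 /mscale /= /msum /= !big_ord_recl big_ord0 !diracT adde0.
by rewrite -!EFinD -EFinM -(_ : 3 = 1 + (1 + 1) :> R) ?mulVf// -!natrD.
Qed.

HB.instance Definition _ := Measure_isProbability.Build _ _ R P2 P2_setT.

Definition P : set (measurableTypeR R) -> \bar R :=
  measure_add (mscale (2^-1)%:nng P1) (mscale (2^-1)%:nng P2).

HB.instance Definition _ := Measure.on P.

Let P_setT : P setT = 1%E.
Proof.
rewrite /P measure_addE /= /mscale /= !probability_setT !mule1.
by rewrite -EFinD [in RHS](splitr 1) mul1r.
Qed.

HB.instance Definition _ := Measure_isProbability.Build _ _ R P P_setT.

End distributions.

Arguments P1 R : clear implicits.
Arguments P2 R : clear implicits.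
Arguments P R : clear implicits.

(* Main.v *)
Require Import Defs.
From mathcomp Require Import all_boot all_order all_algebra finmap.
From mathcomp Require Import all_classical all_reals all_analysis.
From mathcomp Require Import measurable_realfun.
From mathcomp Require Import ring lra zify.

Set Implicit Arguments.
Unset Strict Implicit.
Unset Printing Implicit Defensive.

Import Order.TTheory GRing.Theory Num.Theory.
Import numFieldNormedType.Exports.

(** Both distributions have quantization error between c / n^2 and C / n^2,
    which forces the ratio to tend to 1.  Lower bound: the points at distance
    less than r := 1 / (8 n) from n given centers have P1-mass at most
    4 r n = 1 / 2, so the remaining points, of P-mass at least 1 / 4, each
    contribute at least r^2.  Upper bound: spend three centers on the atoms D
    and spread the others evenly over [0, 1/2]. *)

Local Open Scope classical_set_scope.
Local Open Scope ring_scope.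

(** * Error of order n^-2 forces the ratio to tend to 1 *)

Section asymptotics.
Context {R : realType}.

Lemma cvgn_ln : (fun n : nat => ln n%:R : R) @ \oo --> +oo.
Proof.
apply/cvgryPge => A.
have [N hN] : exists N : nat, expR A <= N%:R.
  by exists (Num.bound (expR A)); exact/ltW/archi_boundP/expR_ge0.
exists N => // n /= Nn.
have h : expR A <= n%:R by rewrite (le_trans hN)// ler_nat.
by rewrite -ler_expR lnK// posrE (lt_le_trans (expR_gt0 A)).
Qed.

(** Taking logarithms puts -ln V_n / (2 ln n) between 1 - ln c2 / (2 ln n) and 1 - ln c1 / (2 ln n).
    Both ends tend to 1, so the constants do not affect the limit. *)
Lemma quantization_ratio_cvg1 (Q : probability (measurableTypeR R) R)
    (c1 c2 : R) :
    0 < c1 -> 0 < c2 ->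
    (\forall n \near \oo,
      c1 / n%:R ^+ 2 <= quantization_error Q n <= c2 / n%:R ^+ 2) ->
  quantization_ratio Q @ \oo --> (1 : R).
Proof.
move=> c10 c20 hQ.
have cst_ln0 (c : R) : (fun n : nat => 1 - c / (2 * ln n%:R)) @ \oo --> (1 : R).
  rewrite -[X in _ --> X]subr0; apply: cvgB; first exact: cvg_cst.
  rewrite -(mulr0 c); apply: cvgMr.
  apply/gtr0_cvgV0.
    have /cvgryPgt/(_ 0) := cvgn_ln; apply: filterS => n; lra.
  apply/cvgryPge => A; have /cvgryPge/(_ (A / 2)) := cvgn_ln.
  by apply: filterS => n; lra.
(* The reciprocal of the ratio has the unknown error in its numerator, where the squeeze is linear;
   inversion is continuous at 1. *)
suff h : (fun n => - ln (quantization_error Q n) / (2 * ln n%:R)) @ \oo -->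
    (1 : R).
  rewrite (_ : quantization_ratio Q =
    (fun n => (- ln (quantization_error Q n) / (2 * ln n%:R))^-1)).
    by rewrite -[X in _ --> X]invr1; exact: cvgV.
  (* Valid for every n, even where a logarithm vanishes, because the inverse of 0 is 0. *)
  by apply/funext => n; rewrite invf_div.
apply: (squeeze_cvgr _ (cst_ln0 (ln c2)) (cst_ln0 (ln c1))).
have /cvgryPgt/(_ 0) ln_gt0 := cvgn_ln.
near=> n.
have n0 : 0 < n%:R :> R by rewrite ltr0n; near: n; exists 1%N.
have l0 : 0 < ln n%:R :> R by near: n.
have /andP[V1 V2] : c1 / n%:R ^+ 2 <= quantization_error Q n <= c2 / n%:R ^+ 2.
  by near: n.
have ln_div c : 0 < c -> ln (c / n%:R ^+ 2) = ln c - 2 * ln n%:R :> R.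
  by move=> c0; rewrite ln_div ?posrE ?exprn_gt0// lnXn// mulr_natl.
have V0 : 0 < quantization_error Q n.
  by apply: lt_le_trans V1; rewrite divr_gt0 ?exprn_gt0.
have ler_ln' (x y : R) : 0 < x -> x <= y -> ln x <= ln y.
  by move=> x0 xy; rewrite ler_ln// posrE// (lt_le_trans x0).
have := ler_ln' _ _ _ V1; have := ler_ln' _ _ V0 V2.
rewrite divr_gt0 ?exprn_gt0// !ln_div// => {}V2 /(_ isT) {}V1.
rewrite ler_pdivlMr ?mulr_gt0// ler_pdivrMr ?mulr_gt0//.
rewrite !mulrBl !divfK ?mulf_neq0 ?gt_eqF//; lra.
Unshelve. all: by end_near. Qed.

End asymptotics.

(** * Distortion estimates by covering and by explicit centers *)

Section distortion_bounds.
Context {R : realType}.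
Implicit Types (Q : probability (measurableTypeR R) R) (alpha : {fset R}).

Definition thickening alpha (r : R) : set (measurableTypeR R) :=
  \big[setU/set0]_(a <- alpha) (ball a r : set (measurableTypeR R)).

Lemma measurable_thickening alpha r : measurable (thickening alpha r).
Proof. by apply: bigsetU_measurable => a _; exact: measurable_ball. Qed.

Lemma measurable_min_sqr alpha :
  measurable_fun [set: measurableTypeR R]
    (fun x : R => \big[Order.min/+oo%E]_(a <- alpha) ((x - a) ^+ 2)%:E).
Proof.
elim: (enum_fset alpha) => [|a s ih].
  by under eq_fun do rewrite big_nil; exact: measurable_cst.
under eq_fun do rewrite big_cons.
apply: measurable_mine => //.
apply/measurable_EFinP; apply: measurable_funX.
exact: measurable_funB.
Qed.

Lemma min_sqr_ge0 alpha (x : R) :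
  (0 <= \big[Order.min/+oo]_(a <- alpha) ((x - a) ^+ 2)%:E)%E.
Proof. by apply: le_bigmin => // a _; rewrite lee_fin sqr_ge0. Qed.

(** A Chebyshev-type bound: the balls are open, so off the thickening every center is at distance at
    least [r] and the integrand is at least [r ^+ 2]. *)
Lemma distortion_ge Q alpha (r : R) : 0 <= r ->
  ((r ^+ 2)%:E * Q (~` thickening alpha r) <= distortion Q alpha)%E.
Proof.
move=> r0; have mT := measurableC (measurable_thickening alpha r).
rewrite -integral_cst// /distortion.
apply: (@le_trans _ _ (\int[Q]_(x in ~` thickening alpha r)
    \big[Order.min/+oo]_(a <- alpha) ((x - a) ^+ 2)%:E)%E); last first.
  apply: ge0_subset_integral => //; first exact: measurable_min_sqr.
  by move=> x _; exact: min_sqr_ge0.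
apply: ge0_le_integral => //.
- by move=> x _; rewrite lee_fin sqr_ge0.
- exact: (measurable_funTS (measurable_min_sqr alpha)).
- move=> x; rewrite /thickening -bigcup_seq => Tx.
  (* The first goal concerns the neutral element +oo of the minimum. *)
  rewrite big_seq; apply: le_bigmin; first by rewrite leey.
  move=> a aalpha; rewrite lee_fin.
  rewrite -[leRHS]real_normK ?num_real// ler_pXn2r// ?nnegrE// distrC leNgt.
  by apply/negP => ax; apply: Tx; exists a.
Qed.

Lemma distortion_le Q alpha (c : R) (S : set (measurableTypeR R)) :
    measurable S -> Q (~` S) = 0%E -> 0 <= c ->
    (forall x : R, S x -> exists2 a, a \in alpha & (x - a) ^+ 2 <= c) ->
  (distortion Q alpha <= c%:E)%E.
Proof.
move=> mS QS c0 hS.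
rewrite /distortion (ge0_negligible_integral (measurableC mS))//; last 2 first.
- exact: measurable_min_sqr.
- by move=> x _; exact: min_sqr_ge0.
rewrite setTD setCK.
apply: (@le_trans _ _ (\int[Q]_(x in S) c%:E)%E).
  apply: ge0_le_integral => //.
  - by move=> x _; exact: min_sqr_ge0.
  - exact: (measurable_funTS (measurable_min_sqr alpha)).
  - move=> x /hS[a aalpha xac].
    by apply: bigmin_inf_seq aalpha _ _; rewrite ?lee_fin.
rewrite integral_cst// -[leRHS]mule1; apply: lee_wpmul2l.
  by rewrite lee_fin.
exact: probability_le1.
Qed.

(** The density of [P1] is 2 on [0, 1/2] and 0 elsewhere. *)
Lemma P1_le (A : set (measurableTypeR R)) : measurable A ->
  (P1 R A <= 2%:E * @lebesgue_measure R A)%E.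
Proof.
move=> mA; rewrite /P1 /uniform_prob -integral_cst//.
apply: ge0_le_integral => //.
- by move=> x _; rewrite lee_fin uniform_pdf_ge0// half_gt0.
- apply/measurable_EFinP; exact: measurable_funTS (measurable_uniform_pdf _ _).
- move=> x _; rewrite lee_fin /uniform_pdf; case: ifPn => // _.
  by rewrite subr0 invrK.
Qed.

(** Subadditivity over the centers: each ball has length 2r, hence [P1]-mass at most 4r. *)
Lemma P1_thickening_le alpha (r : R) : 0 <= r ->
  (P1 R (thickening alpha r) <= (4 * r *+ #|` alpha|)%:E)%E.
Proof.
move=> r0; rewrite /thickening.
elim: (enum_fset alpha) => [|a s ih].
  by rewrite big_nil measure0 lee_fin mulr0n.
rewrite big_cons /= mulrS EFinD.
apply: le_trans.
  apply: measureU2; first exact: measurable_ball.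
  by apply: bigsetU_measurable => b _; exact: measurable_ball.
apply: leeD => //.
apply: le_trans; first by apply: P1_le; exact: measurable_ball.
by rewrite lebesgue_measure_ball// -EFinM lee_fin -mulr_natl; lra.
Qed.

(** The two real bounds make the infimum finite, so [fine] preserves it instead of sending it to
    0. *)
Lemma quantization_error_bounds Q n (c1 c2 : R) :
    (forall alpha, (1 <= #|` alpha| <= n)%N ->
      (c1%:E <= distortion Q alpha)%E) ->
    (exists2 alpha, (1 <= #|` alpha| <= n)%N &
      (distortion Q alpha <= c2%:E)%E) ->
  c1 <= quantization_error Q n <= c2.
Proof.
move=> h1 [alpha alphan h2]; rewrite /quantization_error.
set I := ereal_inf _.
have I1 : (c1%:E <= I)%E.
  by apply: le_ereal_inf_tmp => _ [beta betan <-]; exact: h1.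
have I2 : (I <= c2%:E)%E.
  by apply: ge_ereal_inf; exists (distortion Q alpha) => //; exists alpha.
have If : I \is a fin_num.
  rewrite fin_numE -ltNye -ltey (lt_le_trans _ I1) ?ltNyr//.
  by rewrite (le_lt_trans I2) ?ltry.
by rewrite -!lee_fin fineK// I1 I2.
Qed.

(** Domination of half of [P1] is what [P] and [P1] share, so one argument covers both. The constant
    is 256 = 4 * 8^2: mass at least 1/4 at squared distance at least 1 / (8n)^2. *)
Lemma distortion_lower_bound Q n alpha :
    (forall A, measurable A -> (2^-1%:E * P1 R A <= Q A)%E) ->
    (1 <= #|` alpha| <= n)%N ->
  ((256^-1 / n%:R ^+ 2)%:E <= distortion Q alpha)%E.
Proof.
move=> hQ /andP[alpha1 alphan].
have n0 : 0 < n%:R :> R by rewrite ltr0n (leq_trans alpha1).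
have r0 : 0 <= (8 * n%:R)^-1 :> R by rewrite invr_ge0 mulr_ge0// ltW.
apply: le_trans (distortion_ge Q alpha r0).
have := P1_thickening_le alpha r0.
set T := thickening _ _ => P1T_le; have mT : measurable T.
  exact: measurable_thickening.
have P1T : (2^-1%:E <= P1 R (~` T))%E.
  have -> : P1 R (~` T) = (1 - P1 R T)%E by exact: probability_setC.
  have : P1 R T \is a fin_num by exact: fin_num_measure.
  move: P1T_le; case: (P1 R T) => // p.
  rewrite -EFinB !lee_fin -mulr_natr => hp _.
  have : (#|` alpha|%:R : R) <= n%:R by rewrite ler_nat.
  move=> /(ler_wpM2l r0).
  rewrite invfM mulfVK ?gt_eqF//.
  move: hp; rewrite invfM; lra.
have QT : (4^-1%:E <= Q (~` T))%E.
  apply: le_trans (hQ _ (measurableC mT)).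
  rewrite (_ : 4^-1 = 2^-1 * 2^-1 :> R); last by field.
  by rewrite EFinM; apply: lee_wpmul2l => //; rewrite lee_fin invr_ge0.
apply: le_trans (lee_wpmul2l _ QT); last by rewrite lee_fin sqr_ge0.
rewrite -EFinM lee_fin le_eqVlt; apply/orP; left; apply/eqP.
by field; rewrite gt_eqF.
Qed.

(** A common set of full mass for [P1] and [P], so that one choice of centers serves both. *)
Definition segment_atoms : set (measurableTypeR R) :=
  `[0, 2^-1] `|` [set` P2_support R].

Lemma measurable_segment_atoms : measurable segment_atoms.
Proof.
apply: measurableU; first exact: measurable_itv.
apply: countable_measurable => [t|]; first exact: measurable_set1.
by apply: finite_set_countable; exact: finite_seq.
Qed.

Lemma distortion_upper_bound Q n : Q (~` segment_atoms) = 0%E -> (5 <= n)%N ->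
  exists2 alpha, (1 <= #|` alpha| <= n)%N &
    (distortion Q alpha <= (25 / n%:R ^+ 2)%:E)%E.
Proof.
(* A grid of mesh 1 / (2m) on [0, 1/2] has m + 1 = n - 3 points, which leaves three centers for the
   atoms. *)
move=> QS n5; set m := (n - 4)%N.
have m0 : 0 < m%:R :> R by rewrite ltr0n subn_gt0.
have n0 : 0 < n%:R :> R by rewrite ltr0n (leq_trans _ n5).
pose s : seq R := [seq k%:R / (2 * m%:R) | k <- iota 0 m.+1] ++ P2_support R.
have mem_s a : a \in s -> a \in [fset x in s]%fset.
  by move=> sa; rewrite in_fset.
exists [fset x in s]%fset.
  apply/andP; split.
    rewrite cardfs_gt0; apply/fset0Pn; exists 1.
    by apply: mem_s; rewrite mem_cat !inE eqxx !orbT.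
  rewrite card_fseq (leq_trans (size_undup _))//.
  by rewrite size_cat size_map size_iota /m /=; lia.
apply: (distortion_le measurable_segment_atoms QS) => [|x].
  by rewrite divr_ge0// sqr_ge0.
case=> [|xD]; last first.
  exists x; last by rewrite subrr expr0n divr_ge0// sqr_ge0.
  by apply: mem_s; rewrite mem_cat [X in _ || X]xD orbT.
rewrite /= in_itv/= => /andP[x0 x2].
(* The grid point just left of [x] is at distance less than 1 / (2m); its index is at most m because
   x <= 1/2. *)
pose k := Num.truncn (2 * m%:R * x).
have /andP[k1 k2] : k%:R <= 2 * m%:R * x < k.+1%:R.
  by apply: truncn_itv; rewrite mulr_ge0// mulr_ge0// ltW.
exists (k%:R / (2 * m%:R)).
  apply: mem_s; rewrite mem_cat; apply/orP; left; apply/mapP; exists k => //.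
  rewrite mem_iota add0n /= ltnS -(@ler_nat R) (le_trans k1)//.
  by have := ler_wpM2l (ltW m0) x2; lra.
(* This uses n >= 5, with equality at n = 5. It gives 1 / (2m) <= 5 / n, whence the constant 25. *)
have m5 : (n%:R <= 5 * m%:R :> R).
  rewrite -natrM ler_nat /m; lia.
rewrite (@le_trans _ _ ((2 * m%:R)^-1 ^+ 2))//; last first.
  rewrite -[25](_ : 5 ^+ 2 = _ :> R); last by lra.
  rewrite -expr_div_n ler_pXn2r// ?nnegrE ?divr_ge0 ?invr_ge0 ?mulr_ge0
    ?(ltW m0) ?(ltW n0)//.
  rewrite -[leLHS]mul1r ler_pdivrMr ?mulr_gt0// mulrAC ler_pdivlMr// mul1r.
  lra.
have e : x - k%:R / (2 * m%:R) = (2 * m%:R * x - k%:R) / (2 * m%:R).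
  by field; rewrite gt_eqF.
rewrite e expr_div_n exprVn ler_pdivrMr ?exprn_gt0 ?mulr_gt0//.
rewrite mulVf ?expf_neq0 ?mulf_neq0 ?gt_eqF//.
rewrite -[leRHS](expr1n _ 2) ler_pXn2r// ?nnegrE ?subr_ge0//.
move: k2; rewrite -natr1; lra.
Qed.

Lemma quantization_ratio_cvg1_of_segment_atoms Q :
    (forall A, measurable A -> (2^-1%:E * P1 R A <= Q A)%E) ->
    Q (~` segment_atoms) = 0%E ->
  quantization_ratio Q @ \oo --> (1 : R).
Proof.
move=> hQ QS; apply: (@quantization_ratio_cvg1 R Q 256^-1 25).
- by rewrite invr_gt0.
- by [].
exists 5%N => // n /= n5; apply: quantization_error_bounds => [alpha|].
  exact: distortion_lower_bound.
exact: distortion_upper_bound.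
Qed.

(** * Support and domination hypotheses for [P1] and [P] *)

Lemma P1_segment_atomsC : P1 R (~` segment_atoms) = 0%E.
Proof.
rewrite /P1 /uniform_prob integral_uniform_pdf.
rewrite (_ : _ `&` _ = set0) ?integral_set0//.
by apply/seteqP; split => // x [/= xS x01]; apply: xS; left.
Qed.

Lemma P2_segment_atomsC : P2 R (~` segment_atoms) = 0%E.
Proof.
rewrite /P2 /mscale /= /msum big1 ?mule0// => -[k k3] _ /=.
rewrite diracE memNset//= => h; apply: h; right => /=.
exact: mem_nth.
Qed.

Lemma P_segment_atomsC : P R (~` segment_atoms) = 0%E.
Proof.
rewrite /P measure_addE /= /mscale /=.
by rewrite P1_segment_atomsC P2_segment_atomsC !mule0 adde0.
Qed.

Lemma P1_ge (A : set (measurableTypeR R)) : (2^-1%:E * P1 R A <= P1 R A)%E.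
Proof.
rewrite -[leRHS]mul1e lee_wpmul2r// lee_fin; lra.
Qed.

Lemma P_ge (A : set (measurableTypeR R)) : (2^-1%:E * P1 R A <= P R A)%E.
Proof.
by rewrite /P measure_addE /= /mscale /= leeDl// mule_ge0.
Qed.

End distortion_bounds.

Theorem mainTheorem3 (R : realType) :
  quantization_dim_exists (P R) /\
  quantization_dim_exists (P1 R) /\
  quantization_dim (P R) = quantization_dim (P1 R) /\
  quantization_dim (P1 R) = 1.
Proof.
have cP : quantization_ratio (P R) @ \oo --> (1 : R).
  apply: quantization_ratio_cvg1_of_segment_atoms => [A _|]; first exact: P_ge.
  exact: P_segment_atomsC.
have cP1 : quantization_ratio (P1 R) @ \oo --> (1 : R).
  apply: quantization_ratio_cvg1_of_segment_atoms => [A _|]; first exact: P1_ge.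
  exact: P1_segment_atomsC.
rewrite /quantization_dim (cvg_lim _ cP)// (cvg_lim _ cP1)//.
split; [|split] => //; [exact: cvgP cP|exact: cvgP cP1].
Qed.
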